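(* Let $n\ge 1$ be an integer, let $P(z)=\sum_{j=0}^{n}a_jz^j$ be a polynomial with complex coefficients $a_0,\dots,a_n$, and let $r>0$. Define $$m(r)=\min_{|z|=r}|P(z)|\quad\text{and}\quad M(r)=\max_{|z|=r}|P(z)|,$$ where $z$ ranges over the complex numbers of modulus $r$. Then $$m(r)^2\le \sum_{j=0}^{n}|a_j|^2\,r^{2j}\le M(r)^2.$$ *)

(* Defs.v *)
From mathcomp Require Import all_boot all_order all_algebra.
From mathcomp Require Import all_classical all_reals all_analysis.
From mathcomp Require Import complex.

Set Implicit Arguments.
Unset Strict Implicit.
Unset Printing Implicit Defensive.

Import Order.TTheory GRing.Theory Num.Theory.
Import numFieldNormedType.Exports.
Import ComplexField.Normc.
Local Open Scope classical_set_scope.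
Local Open Scope ring_scope.

(* The norm `|z| of z : R[i] is itself an element of R[i]; [normc z] is the
   modulus of z as an element of R. *)

Definition circle_moduli (R : realType) (P : {poly R[i]}) (r : R) : set R :=
  [set normc P.[z] | z in [set z : R[i] | normc z = r]].

Definition minimums (R : realType) (A : set R) : set R := A `&` lbound A.

Definition maximums (R : realType) (A : set R) : set R := A `&` ubound A.

(* [xget 0] returns the junk value 0 when there is no minimum (resp. maximum);
   [min_modulusP] and [max_modulusP] show that this never happens for r > 0. *)
Definition min_modulus (R : realType) (P : {poly R[i]}) (r : R) : R :=
  xget 0 (minimums (circle_moduli P r)).

Definition max_modulus (R : realType) (P : {poly R[i]}) (r : R) : R :=
  xget 0 (maximums (circle_moduli P r)).

Section Attained.
Variable R : realType.

Let circ (r t : R) : R[i] := Complex (r * cos t) (r * sin t).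

Let continuous_horner_circ (P : {poly R[i]}) (r : R) :
  continuous (fun t => complex.Re P.[circ r t]) /\
  continuous (fun t => complex.Im P.[circ r t]).
Proof.
elim/poly_ind: P => [|P c [cRe cIm]].
  by split=> t; under eq_fun do rewrite horner0; exact: cvg_cst.
have cC : continuous (fun t : R => r * cos t).
  by move=> t; apply: cvgM; [exact: cvg_cst|exact: continuous_cos].
have cS : continuous (fun t : R => r * sin t).
  by move=> t; apply: cvgM; [exact: cvg_cst|exact: continuous_sin].
have E (t : R) : (P * 'X + c%:P).[circ r t] = Complex
   (complex.Re P.[circ r t] * (r * cos t) -
     complex.Im P.[circ r t] * (r * sin t) + complex.Re c)
   (complex.Re P.[circ r t] * (r * sin t) +
     complex.Im P.[circ r t] * (r * cos t) + complex.Im c).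
  by rewrite hornerMXaddC; case: P.[_] => x y; case: (c).
split=> t; under eq_fun do rewrite E /=.
- apply: cvgD; last exact: cvg_cst.
  by apply: cvgB; apply: cvgM; [exact: cRe|exact: cC|exact: cIm|exact: cS].
- apply: cvgD; last exact: cvg_cst.
  by apply: cvgD; apply: cvgM; [exact: cRe|exact: cS|exact: cIm|exact: cC].
Qed.

Let continuous_modulus (P : {poly R[i]}) (r : R) :
  continuous (fun t => normc P.[circ r t]).
Proof.
have [cRe cIm] := continuous_horner_circ P r.
have -> : (fun t => normc P.[circ r t]) = (fun t => Num.sqrt
    (complex.Re P.[circ r t] * complex.Re P.[circ r t] +
     complex.Im P.[circ r t] * complex.Im P.[circ r t])).
  by apply/funext => t; case: P.[_] => x y; rewrite /= !expr2.
move=> t; apply: (@continuous_comp _ _ _ (fun t => _ + _) Num.sqrt);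
  last exact: sqrt_continuous.
by apply: cvgD; apply: cvgM; [exact: cRe|exact: cRe|exact: cIm|exact: cIm].
Qed.

Let normc_circ (r t : R) : 0 < r -> normc (circ r t) = r.
Proof.
move=> r0; rewrite /= !exprMn -mulrDr cos2Dsin2 mulr1 sqrtr_sqr.
by rewrite ger0_norm// ltW.
Qed.

Let circ_surj (r : R) (z : R[i]) : 0 < r -> normc z = r ->
  exists2 t, t \in `[- pi, pi] & z = circ r t.
Proof.
move=> r0; case: z => x y /= zr.
have r2 : x ^+ 2 + y ^+ 2 = r ^+ 2.
  by rewrite -zr sqr_sqrtr// addr_ge0// sqr_ge0.
have rn0 : r != 0 by rewrite gt_eqF.
have uv : (x / r) ^+ 2 + (y / r) ^+ 2 = 1.
  by rewrite !expr_div_n -mulrDl r2 divff// expf_neq0.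
have xle : -1 <= x / r <= 1.
  rewrite -ler_norml -(@ler_pXn2r _ 2)// ?nnegrE// expr1n real_normK ?num_real//.
  by rewrite -uv lerDl sqr_ge0.
have a0 := acos_ge0 xle; have api := acos_lepi xle.
have pi0 := pi_ge0 R.
have cosa : cos (acos (x / r)) = x / r by apply: acosK; rewrite in_itv.
have sina : sin (acos (x / r)) = `|y / r|.
  rewrite sin_acos// -[in RHS]sqrtr_sqr; congr Num.sqrt.
  by rewrite -uv addrC addKr.
have [y0|y0] := leP 0 (y / r).
- exists (acos (x / r)); first by rewrite in_itv/= api andbT (le_trans _ a0)// oppr_le0.
  by rewrite /circ cosa sina ger0_norm// ![r * _]mulrC !divfK.
- exists (- acos (x / r)).
    by rewrite in_itv/= lerN2 api/= (le_trans _ pi0)// oppr_le0.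
  by rewrite /circ cosN sinN cosa sina ltr0_norm// opprK ![r * _]mulrC !divfK.
Qed.

Lemma min_modulusP (P : {poly R[i]}) (r : R) : 0 < r ->
  minimums (circle_moduli P r) (min_modulus P r).
Proof.
move=> r0; have pi0 := pi_ge0 R.
have [||c cpi cmin] := @EVT_min R (fun t => normc P.[circ r t]) (- pi) pi.
- by rewrite (le_trans _ pi0)// oppr_le0.
- exact/continuous_subspaceT/continuous_modulus.
apply: (xgetPex 0); exists (normc P.[circ r c]); split.
  by exists (circ r c) => //=; exact: normc_circ.
by move=> _ [z /= zr <-]; have [t tpi ->] := circ_surj r0 zr; exact: cmin.
Qed.

Lemma max_modulusP (P : {poly R[i]}) (r : R) : 0 < r ->
  maximums (circle_moduli P r) (max_modulus P r).
Proof.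
move=> r0; have pi0 := pi_ge0 R.
have [||c cpi cmax] := @EVT_max R (fun t => normc P.[circ r t]) (- pi) pi.
- by rewrite (le_trans _ pi0)// oppr_le0.
- exact/continuous_subspaceT/continuous_modulus.
apply: (xgetPex 0); exists (normc P.[circ r c]); split.
  by exists (circ r c) => //=; exact: normc_circ.
by move=> _ [z /= zr <-]; have [t tpi ->] := circ_surj r0 zr; exact: cmax.
Qed.

End Attained.

(* Main.v *)
Require Import Defs.
From mathcomp Require Import all_boot all_order all_algebra.
From mathcomp Require Import all_classical all_reals all_analysis.
From mathcomp Require Import complex.
From mathcomp Require cyclic separable cyclotomic.
Import Order.TTheory GRing.Theory Num.Theory.
Import ComplexField.Normc.
Local Open Scope ring_scope.

(** The sum of the |a_j|^2 r^(2j) is the mean of |P|^2 over finitely many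
    points of the circle |z| = r, so it lies between the squares of the minimum
    and of the maximum of |P| there.  The usual argument averages over the whole
    circle (Parseval's formula for the integral); since P has n+1 coefficients,
    it is enough to average over the n+1 points r w^k, where w is a primitive
    root of unity of order n+1.  Indeed the values P(r w^k) form the discrete
    Fourier transform of the sequence a_j r^j, and the orthogonality of the
    characters k |-> w^(jk) for distinct exponents j <= n
    ([sum_expr_unity_root]) makes the cross terms of the mean of |P|^2 vanish;
    this is the discrete Parseval identity [discrete_parseval]. *)

(** 'X^n - 1 is separable when n is invertible, so in a closed field it has n
    distinct roots; they form a finite group of units of a field, hence a cyclic
    one. *)
Lemma closed_field_prim_root_exists (F : closedFieldType) (n : nat) :
  (n%:R != 0 :> F) -> exists w : F, n.-primitive_root w.
Proof.
move=> n_neq0.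
have n_gt0 : (0 < n)%N by case: n n_neq0 => //; rewrite eqxx.
have [s] := closed_field_poly_normal ('X^n - 1 : {poly F}).
rewrite (monicP (monicXnsubC 1 n_gt0)) scale1r => Xn1E.
have s_unity : all n.-unity_root s.
  by apply/allP => z; rewrite unity_rootE -root_prod_XsubC -Xn1E rootE !hornerE
    subr_eq0.
have s_uniq : uniq s.
  by rewrite -separable.separable_prod_XsubC -Xn1E
    cyclotomic.separable_Xn_sub_1.
have s_size : (n <= size s)%N.
  by rewrite -ltnS -(size_prod_XsubC s id) -Xn1E size_XnsubC.
have /hasP[w _ w_prim] := cyclic.has_prim_root n_gt0 s_unity s_uniq s_size.
by exists w.
Qed.

Lemma sum_expr_unity_root {F : idomainType} {n : nat} {x : F} :
  x ^+ n = 1 -> \sum_(k < n) x ^+ k = (x == 1)%:R * n%:R.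
Proof.
move=> xn1; have [->|x_neq1] := eqVneq x 1.
  under eq_bigr do rewrite expr1n.
  by rewrite sumr_const card_ord mul1r.
have /eqP := subrX1 x n.
by rewrite xn1 subrr eq_sym mulf_eq0 subr_eq0 (negPf x_neq1) mul0r => /eqP.
Qed.

Lemma norm_prim_root {C : numClosedFieldType} {n : nat} {w : C} :
  n.-primitive_root w -> `|w| = 1.
Proof.
move=> w_prim; have n_gt0 := prim_order_gt0 w_prim.
apply/eqP; rewrite -(@pexpr_eq1 _ _ n) ?normr_ge0 //.
by rewrite -normrX (prim_expr_order w_prim) normr1.
Qed.

(** Expanding |z|^2 as z times its conjugate gives a sum over pairs (j, l) of
    b_j times the conjugate of b_l, weighted by a geometric sum in the ratio
    w^j / w^l; orthogonality leaves the diagonal only. *)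
Lemma discrete_parseval {C : numClosedFieldType} {n : nat} {w : C}
    (b : 'I_n -> C) : n.-primitive_root w ->
  \sum_(k < n) `|\sum_(j < n) b j * w ^+ (k * j)| ^+ 2 =
    n%:R * \sum_(j < n) `|b j| ^+ 2.
Proof.
move=> w_prim.
have w_neq0 : w != 0 by rewrite -normr_gt0 (norm_prim_root w_prim).
have conj_w : w^* = w^-1.
  by apply: (mulfI w_neq0); rewrite divff// -normCK (norm_prim_root w_prim)
    expr1n.
pose x (j l : 'I_n) := w ^+ j / w ^+ l.
have x_unity j l : x j l ^+ n = 1.
  by rewrite expr_div_n -!exprM ![(_ * n)%N]mulnC !exprM
    (prim_expr_order w_prim) !expr1n divr1.
have x_eq1 j l : (x j l == 1) = (l == j).
  rewrite -(inj_eq (mulIf (expf_neq0 l w_neq0))) mul1r divfK ?expf_neq0//.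
  by rewrite (eq_prim_root_expr w_prim) !modn_small ?ltn_ord// eq_sym.
transitivity (\sum_(k < n) \sum_(j < n) \sum_(l < n)
    (b j * (b l)^*) * x j l ^+ k).
  apply: eq_bigr => k _; rewrite normCK rmorph_sum mulr_suml.
  apply: eq_bigr => j _; rewrite mulr_sumr; apply: eq_bigr => l _.
  rewrite rmorphM rmorphXn /= conj_w mulrACA; congr (_ * _).
  by rewrite expr_div_n -!exprM exprVn ![(k * _)%N]mulnC.
rewrite exchange_big mulr_sumr; apply: eq_bigr => j _.
rewrite exchange_big (bigD1 j)//= [X in _ + X]big1 ?addr0 => [|l l_neq_j].
  by rewrite -mulr_sumr sum_expr_unity_root// x_eq1 eqxx mul1r mulrC -normCK.
by rewrite -mulr_sumr sum_expr_unity_root// x_eq1 (negPf l_neq_j) mul0r mulr0.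
Qed.

Lemma normcE {R : rcfType} (z : R[i]) : (`|z| = (normc z)%:C)%C.
Proof. by case: z. Qed.

Lemma mean_sqr_normc_horner {R : rcfType} {n : nat} (a : nat -> R[i]) {r : R}
    {w : R[i]} : 0 <= r -> n.-primitive_root w ->
  \sum_(k < n) normc (\poly_(j < n) a j).[(r%:C)%C * w ^+ k] ^+ 2 =
    n%:R * \sum_(j < n) normc (a j) ^+ 2 * r ^+ (2 * j).
Proof.
move=> r_ge0 w_prim; apply: complexI.
rewrite rmorphM rmorph_nat !rmorph_sum /=.
transitivity (\sum_(k < n)
    `|\sum_(j < n) a j * (r%:C)%C ^+ j * w ^+ (k * j)| ^+ 2).
  apply: eq_bigr => k _; rewrite rmorphXn /= -normcE horner_poly.
  congr (`|_| ^+ 2); apply: eq_bigr => j _.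
  by rewrite exprMn -exprM mulrA.
rewrite (discrete_parseval _ w_prim); congr (_ * _); apply: eq_bigr => j _.
rewrite rmorphM !rmorphXn /= -normcE normrM exprMn normrX.
by rewrite (@ger0_norm _ (r%:C)%C) ?lecR// -exprM mulnC.
Qed.

Theorem lemma3p1 (R : realType) (n : nat) (hn : (1 <= n)%N)
    (a : nat -> R[i]) (r : R) (hr : 0 < r) :
  let P : {poly R[i]} := \poly_(j < n.+1) a j in
  min_modulus P r ^+ 2 <=
    \sum_(j < n.+1) normc (a j) ^+ 2 * r ^+ (2 * j) <=
    max_modulus P r ^+ 2.
Proof.
cbv zeta.
set P := \poly_(j < n.+1) a j.
have [w w_prim] : exists w : R[i], n.+1.-primitive_root w.
  by apply: closed_field_prim_root_exists; rewrite pnatr_eq0.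
have [[z0 _ minE] min_le] := min_modulusP P hr.
have [_ le_max] := max_modulusP P hr.
have onP k : circle_moduli P r (normc P.[(r%:C)%C * w ^+ k]).
  exists ((r%:C)%C * w ^+ k) => //=; apply: complexI.
  by rewrite -normcE normrM normrX (norm_prim_root w_prim) expr1n mulr1
    ger0_norm// lecR ltW.
have normc_ge0 (z : R[i]) : 0 <= normc z by case: z => x y; exact: sqrtr_ge0.
have min_ge0 : 0 <= min_modulus P r by rewrite -minE.
have N_gt0 : 0 < n.+1%:R :> R by rewrite ltr0n.
have sum_cst (c : R) : n.+1%:R * c = \sum_(k < n.+1) c.
  by rewrite sumr_const card_ord mulr_natl.
apply/andP; split; rewrite -(ler_pM2l N_gt0);
    rewrite -(mean_sqr_normc_horner a (ltW hr) w_prim) -/P sum_cst;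
    apply: ler_sum => k _.
  by rewrite lerXn2r ?nnegrE//; exact: min_le (onP k).
have le_maxk := le_max _ (onP k).
by rewrite lerXn2r ?nnegrE// (le_trans _ le_maxk).
Qed.
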